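(* (Conjecture 3.8 of Monical, Tokcan and Yong is true.) Let $n\ge1$ and $\alpha\in\mathbb{Z}_{\ge0}^n$, and let $\widehat{\mathcal{P}}_\alpha=\mathrm{conv}(\{\beta\in\mathbb{Z}^n:\beta\le_S\alpha\})$. If $\beta\in\widehat{\mathcal{P}}_\alpha$ and $\beta\in\mathbb{Z}_{\ge0}^n$, then $\beta\le_S\alpha$.
   Context: The Bruhat order $\le_S$ on $\mathbb{Z}^n$ is the partial order obtained as the (reflexive and) transitive closure of the following relations: for $\lambda\in\mathbb{Z}^n$ and $1\le i<j\le n$ with $\lambda_i<\lambda_j$, set $\lambda>_S s_{ij}(\lambda)$, where $s_{ij}$ swaps the $i$-th and $j$-th coordinates; and if in addition $\lambda_j-\lambda_i>1$, set $s_{ij}(\lambda)>_S\lambda+e_i-e_j$. Here $e_1,\dots,e_n$ is the standard basis of $\mathbb{Z}^n$. *)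

(* Defs.v *)
From Stdlib Require Import Relation_Operators.
From mathcomp Require Import all_boot all_order all_algebra.
From mathcomp Require Import classical_sets reals convex.

Set Implicit Arguments.
Unset Strict Implicit.
Unset Printing Implicit Defensive.

Import Order.TTheory GRing.Theory Num.Theory.
Local Open Scope classical_set_scope.
Local Open Scope ring_scope.

(* [bruhat_gen l m] reads l >_S m: the left argument is the larger one.
   Vectors of Z^n are row vectors; [xcol i j l] is s_ij(l), and
   [delta_mx 0 i] is the standard basis vector e_i. *)
Inductive bruhat_gen (n : nat) : 'rV[int]_n -> 'rV[int]_n -> Prop :=
| bruhat_gen_swap (l : 'rV[int]_n) (i j : 'I_n) :
    (i < j)%N -> l 0 i < l 0 j ->
    bruhat_gen l (xcol i j l)
| bruhat_gen_move (l : 'rV[int]_n) (i j : 'I_n) :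
    (i < j)%N -> l 0 i < l 0 j -> 1 < l 0 j - l 0 i ->
    bruhat_gen (xcol i j l) (l + delta_mx 0 i - delta_mx 0 j).

(* [bruhat_le b a] reads b <=_S a. *)
Definition bruhat_le (n : nat) (b a : 'rV[int]_n) : Prop :=
  clos_refl_trans _ (@bruhat_gen n) a b.

Definition convex_hull (R : numDomainType) (M : lmodType R) (A : set M) :
    set M :=
  smallest (@convex_set R M) A.

Definition int_vec (R : realType) (n : nat) (v : 'rV[int]_n) : 'rV[R]_n :=
  map_mx intr v.
Arguments int_vec R {n} v.

Definition P_hat (R : realType) (n : nat) (a : 'rV[int]_n) : set 'rV[R]_n :=
  convex_hull [set int_vec R b | b in [set b | bruhat_le b a]].
Arguments P_hat R {n} a _.

(* Main.v *)
(* The Bruhat order on Z^n is generated by the affine reflections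
   (x_i, x_j) |-> (x_j + c, x_i - c) that bring a vector closer to the fundamental
   alcove. For a simple reflection r with a < r a, the lifting property gives
   x <= r a iff min (x, r x) <= a. We show, by induction along simple reflections,
   that the down-set D(a) of every a is the set of lattice points x of a base polytope
   x(A) <= f(A), x([n]) = f([n]) with f submodular and integral. If this holds for
   a with f, the candidate for r a is the support function g of the union of D(a)
   and r D(a). Given a lattice point x of the polytope of g with x <= r x,
   one must push x along e_j - e_i into the polytope of f; the lower and upper
   bounds on the integral length of the push are compatible by submodularity, and
   x lies below the pushed point. Finally the convex hull of D(a) satisfies the same
   linear inequalities, so its lattice points are in D(a). *)
Require Import Defs.
From Stdlib Require Import Relation_Operators.
From mathcomp Require Import all_boot all_order all_algebra.
From mathcomp Require Import perm zify ring.
From mathcomp Require Import boolp classical_sets reals interval_inference.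
From mathcomp Require Import convex.

Import Order.TTheory GRing.Theory Num.Theory.
Local Open Scope classical_set_scope.
Local Open Scope ring_scope.

Section Bruhat.
Set Implicit Arguments.
Unset Strict Implicit.
Context {n : nat}.
Implicit Types (x y z a : 'rV[int]_n) (i j k : 'I_n) (c t : int).
Implicit Types (A B : {set 'I_n}).

(** * Affine reflections and the order they generate *)

Definition shift i j t x : 'rV[int]_n :=
  x + t *: (delta_mx 0 i - delta_mx 0 j).

Definition refl i j c x := shift i j (x 0 j - x 0 i + c) x.

(* [refl i j c] is the affine reflection of the root (e_i - e_j, c); exactly one
   of (i, j, c) and (j, i, - c), which give the same reflection, has positive
   height, and the roots of height 1 are the simple ones. *)
Definition height i j c : int := n%:Z * c + i%:Z - j%:Z.

Inductive step y : 'rV[int]_n -> Prop :=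
| Step i j c : i != j -> 0 < height i j c -> c < y 0 i - y 0 j ->
    step y (refl i j c y).

Definition step_le x y := clos_refl_trans _ step y x.

Lemma shiftE i j t x k :
  shift i j t x 0 k = x 0 k + t * ((k == i)%:R - (k == j)%:R).
Proof. by rewrite !mxE eqxx. Qed.

Lemma reflE i j c x k : i != j ->
  refl i j c x 0 k =
  if k == i then x 0 j + c else if k == j then x 0 i - c else x 0 k.
Proof.
move=> nij; rewrite shiftE.
case: (eqVneq k i) => [->|_]; first by rewrite (negbTE nij); lia.
by case: (eqVneq k j) => [->|_]; lia.
Qed.

Lemma reflK i j c : i != j -> involutive (refl i j c).
Proof.
move=> nij x; apply/rowP=> k; rewrite !reflE // !eqxx (eq_sym j) (negbTE nij).
by case: eqVneq => [->|_]; [lia|case: eqVneq => [->|_]; lia].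
Qed.

Lemma step_le_refl x : step_le x x.
Proof. exact: rt_refl. Qed.

Lemma step_le_trans y x z : step_le x y -> step_le y z -> step_le x z.
Proof. by move=> xy yz; apply: rt_trans yz xy. Qed.

Lemma step_leW y z : step y z -> step_le z y.
Proof. exact: rt_step. Qed.

Definition high i j c x := c < x 0 i - x 0 j.

Lemma refl_le i j c x : i != j -> 0 < height i j c -> high i j c x ->
  step_le (refl i j c x) x.
Proof. by move=> nij h hx; apply/step_leW/Step. Qed.

Lemma high_refl i j c x : i != j ->
  high i j c (refl i j c x) = (x 0 i - x 0 j < c).
Proof.
by move=> nij; rewrite /high !reflE // !eqxx (eq_sym j) (negbTE nij); lia.
Qed.

Lemma refl_id i j c x : i != j -> x 0 i - x 0 j = c -> refl i j c x = x.
Proof.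
move=> nij xE; apply/rowP=> k; rewrite reflE //.
by case: eqVneq => [->|_]; [lia|case: eqVneq => [->|_]; lia].
Qed.

Lemma refl_ge i j c x : i != j -> 0 < height i j c -> ~~ high i j c x ->
  step_le x (refl i j c x).
Proof.
move=> nij h0; rewrite /high -leNgt le_eqVlt => /predU1P[xE|hx].
  by rewrite refl_id //; apply: step_le_refl.
by rewrite -{1}(reflK c nij x); apply: refl_le; rewrite ?high_refl.
Qed.

(** A nonzero multiple of [n] outweighs [i - j], so every real affine root is positive or
    negative. *)
Lemma height_neq0 i j c : i != j -> height i j c != 0.
Proof.
move=> nij; rewrite /height; have := ltn_ord i; have := ltn_ord j.
have : (i : nat) != j by [].
have [->|?] := eqVneq c 0; first by lia.
have [?|?] : c <= -1 \/ 1 <= c by lia.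
  by nia.
by nia.
Qed.

Lemma refl_conj i j c p q d x : i != j -> p != q ->
  let s := tperm i j in
  let off k : int := if k == i then c else if k == j then - c else 0 in
  refl i j c (refl p q d x) =
  refl (s p) (s q) (d + off (s p) - off (s q)) (refl i j c x).
Proof.
move=> nij npq s off.
have nspq : s p != s q by rewrite (inj_eq perm_inj).
have rE y k : refl i j c y 0 k = y 0 (s k) + off k.
  rewrite reflE // /off /s.
  case: eqVneq => [->|ki]; first by rewrite tpermL.
  case: eqVneq => [->|kj]; first by rewrite tpermR.
  by rewrite tpermD 1?eq_sym// addr0.
apply/rowP=> k; rewrite rE -[k](tpermK i j) -/s -/(s k).
move: (s k) => l; rewrite (@reflE p) // (@reflE (s p)) //.
rewrite !(inj_eq perm_inj) !rE !tpermK.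
case: eqVneq => [->|lp]; first by lia.
by case: eqVneq => [->|lq]; lia.
Qed.

(* A reflection of height 1 permutes the positive affine roots other than its
   own, so conjugating by it preserves the direction of every other step. *)
Lemma step_refl i j c y z : i != j -> height i j c = 1 ->
  step y z -> z = refl i j c y \/ step (refl i j c y) (refl i j c z).
Proof.
move=> nij hr [p q d npq ht hy].
case: (boolP [&& p == i, q == j & d == c]) => [/and3P[/eqP-> /eqP-> /eqP->]|E].
  by left.
right; rewrite refl_conj //.
have nspq : tperm i j p != tperm i j q by rewrite (inj_eq perm_inj).
apply: Step => //; last first.
  rewrite !reflE //; move: npq hy E.
  case: tpermP => [->|->|/eqP/negbTE pi /eqP/negbTE pj];
  case: tpermP => [->|->|/eqP/negbTE qi /eqP/negbTE qj];
  rewrite ?eqxx ?(eq_sym j) ?(negbTE nij) ?pi ?pj ?qi ?qj //=; lia.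
(* Conjugation lowers the height by at most 2. A drop of 1 could at worst reach 0, which
   [height_neq0] excludes. A drop of 2 needs [p = i] and [q = j]; the old height is then
   [1 + n * (d - c)] with [c < d] and [1 < n]. *)
have := height_neq0 (d + (if tperm i j p == i then c
    else if tperm i j p == j then - c else 0) -
   (if tperm i j q == i then c else if tperm i j q == j then - c else 0)) nspq.
have := ltn_ord i; have := ltn_ord j.
move: npq ht hr E hy nspq; rewrite /height.
case: tpermP => [->|->|/eqP/negbTE pi /eqP/negbTE pj];
  case: tpermP => [->|->|/eqP/negbTE qi /eqP/negbTE qj];
  rewrite ?eqxx ?(eq_sym j) ?(negbTE nij) ?pi ?pj ?qi ?qj //=; try nia.
Qed.

(** * The lifting property *)

Definition low i j c x := if high i j c x then refl i j c x else x.
Definition up i j c x := if high i j c x then x else refl i j c x.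

Lemma low_refl i j c x : i != j -> low i j c (refl i j c x) = low i j c x.
Proof.
move=> nij; rewrite /low high_refl // reflK // /high.
by case: ltgtP => // xE; rewrite refl_id.
Qed.

Lemma up_refl i j c x : i != j -> up i j c (refl i j c x) = up i j c x.
Proof.
move=> nij; rewrite /up high_refl // reflK // /high.
by case: ltgtP => // xE; rewrite refl_id.
Qed.

Lemma low_le i j c x : i != j -> 0 < height i j c -> step_le (low i j c x) x.
Proof.
by move=> nij h0; rewrite /low; case: ifP => hx;
  [exact: refl_le|exact: step_le_refl].
Qed.

Lemma up_ge i j c x : i != j -> 0 < height i j c -> step_le x (up i j c x).
Proof.
by move=> nij h0; rewrite /up; case: ifPn => hx;
  [exact: step_le_refl|exact: refl_ge].
Qed.

(** It suffices to treat one step from [y] to [z]. If it is the reflection itself, [low] and [up] do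
    not change. Otherwise [step_refl] gives a parallel step between the reflected points, and one of
    the two steps joins the required elements. *)
Lemma lifting i j c x a : i != j -> height i j c = 1 -> step_le x a ->
  step_le (low i j c x) (low i j c a) /\ step_le (up i j c x) (up i j c a).
Proof.
move=> nij h1; have h0 : 0 < height i j c by rewrite h1.
elim=> {x a} [y z yz|x|x y z _ [IH1 IH2] _ [IH3 IH4]]; first last.
- by split; [apply: step_le_trans IH3 IH1|apply: step_le_trans IH4 IH2].
- by split; apply: step_le_refl.
have [->|rs] := step_refl nij h1 yz.
  by rewrite low_refl // up_refl //; split; apply: step_le_refl.
split.
  rewrite {2}/low; case: ifP => _; last first.
    exact: step_le_trans (low_le _ nij h0) (step_leW yz).
  rewrite -low_refl //.
  exact: step_le_trans (low_le _ nij h0) (step_leW rs).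
rewrite {1}/up; case: ifP => _.
  exact: step_le_trans (step_leW yz) (up_ge _ nij h0).
by rewrite -(up_refl c y nij); apply: step_le_trans (step_leW rs) (up_ge _ nij h0).
Qed.

(** For [0 < t], [x] is the image of the shifted point under a reflection with a parallel root;
    since [x] is not high, that root has height at least [n * t - 1 > 0]. *)
Lemma le_shift i j c x t : i != j -> height i j c = 1 -> ~~ high i j c x ->
  0 <= t -> step_le x (shift j i t x).
Proof.
move=> nij h1 lx; rewrite le_eqVlt => /predU1P[<-|t0].
  rewrite /shift scale0r addr0; exact: step_le_refl.
have ni : j != i by rewrite eq_sym.
set y := shift j i t x.
have yi : y 0 i = x 0 i - t by rewrite shiftE eqxx (negbTE nij); lia.
have yj : y 0 j = x 0 j + t by rewrite shiftE eqxx (negbTE ni); lia.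
pose e := y 0 j - y 0 i - t.
have -> : x = refl j i e y.
  apply/rowP=> k; rewrite reflE // yi yj /e.
  case: (eqVneq k j) => [->|kj]; first by lia.
  case: (eqVneq k i) => [->|ki]; first by lia.
  by rewrite shiftE (negbTE kj) (negbTE ki); lia.
apply/step_leW/Step => //; last by rewrite /e; lia.
move: h1 lx; rewrite /height /high -leNgt /e yi yj.
have n1 : (1 < n)%N.
  have := ltn_ord i; have := ltn_ord j; have : (i : nat) != j by []; lia.
by move: (x 0 i) (x 0 j) => u v; nia.
Qed.

(** * Weights of index sets and down-sets as base polytopes *)

Definition wt A x := \sum_(k in A) x 0 k.

Lemma wt_shift A i j t x :
  wt A (shift i j t x) = wt A x + t * ((i \in A)%:R - (j \in A)%:R).
Proof.
rewrite /wt (eq_bigr _ (fun k _ => shiftE i j t x k)) big_split /=; congr (_ + _).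
rewrite -mulr_sumr big_split /= sumrN; congr (_ * (_ - _)).
  case: (boolP (i \in A)) => iA.
    by rewrite (bigD1 i) //= eqxx big1 ?addr0 // => k /andP[_ /negbTE->].
  by rewrite big1 // => k kA; case: eqVneq iA => // <-; rewrite kA.
case: (boolP (j \in A)) => jA.
  by rewrite (bigD1 j) //= eqxx big1 ?addr0 // => k /andP[_ /negbTE->].
by rewrite big1 // => k kA; case: eqVneq jA => // <-; rewrite kA.
Qed.

Lemma wt_exchange A i j x : i \in A -> j \notin A ->
  wt (j |: (A :\ i)) x = wt A x + x 0 j - x 0 i.
Proof.
move=> iA jA; rewrite /wt big_setU1 ?inE ?(negbTE jA) ?andbF //=.
rewrite [X in _ = X + _ - _](big_setD1 i iA) /=.
by move: (\sum_(k in A :\ i) _) => S; lia.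
Qed.

Lemma wt_modular A B x : wt (A :|: B) x + wt (A :&: B) x = wt A x + wt B x.
Proof.
rewrite /wt (big_setID A) /= [X in _ = _ + X](big_setID A) /=.
rewrite finset.setUK finset.setDUl finset.setDv finset.set0U [B :&: A]finset.setIC.
by rewrite -addrA [X in _ + X]addrC.
Qed.

(* The down-set of [a] is the set of lattice points of the base polytope of the
   submodular function [f]. *)
Record polymatroidal a (f : {set 'I_n} -> int) : Prop := Polymatroidal {
  pm_submod A B : f (A :|: B) + f (A :&: B) <= f A + f B;
  pm_attained A : exists2 x, step_le x a & wt A x = f A;
  pm_bound x A : step_le x a -> wt A x <= f A;
  pm_saturated x :
    (forall A, wt A x <= f A) -> wt [set: _] x = wt [set: _] a -> step_le x a
}.

Lemma wt_refl A i j c x :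
  wt A (refl i j c x) =
  wt A x + (x 0 j - x 0 i + c) * ((i \in A)%:R - (j \in A)%:R).
Proof. exact: wt_shift. Qed.

Lemma step_le_total x a : step_le x a -> wt [set: _] x = wt [set: _] a.
Proof.
elim=> {x a} [y _ [i j c _ _ _]|//|x y z _ -> _ ->//].
by rewrite wt_refl !inE subrr mulr0 addr0.
Qed.

Lemma step_le_reflE i j c x a : i != j -> height i j c = 1 ->
  ~~ high i j c a -> step_le x (refl i j c a) <-> step_le (low i j c x) a.
Proof.
move=> nij h1 la; have h0 : 0 < height i j c by rewrite h1.
split=> [/(lifting nij h1)[+ _]|/(lifting nij h1)[_]].
  by rewrite low_refl // {2}/low (negbTE la).
rewrite {2}/up (negbTE la); apply: step_le_trans.
suff -> : up i j c (low i j c x) = up i j c x by exact: up_ge.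
by rewrite /low; case: ifP; rewrite ?up_refl.
Qed.

Lemma finset_nonneg_max (P : pred {set 'I_n}) (F : {set 'I_n} -> int) :
  exists t, [/\ 0 <= t, forall A, P A -> F A <= t &
    t = 0 \/ exists2 A, P A & t = F A].
Proof.
case: (pickP P) => [A0 PA0|P0]; last first.
  by exists 0; split=> // [A|]; [rewrite P0|left].
have [A PA maxA] := arg_maxP F PA0.
case: (lerP 0 (F A)) => FA.
  by exists (F A); split=> //; right; exists A.
by exists 0; split=> // [B /maxA FB|]; [lia|left].
Qed.

(** * Lifting the rank function along a simple reflection *)

Section Exchange.
Variables (i j : 'I_n).
Hypothesis nij : i != j.

(** If [A] contains [i] but not [j], then [wt A (refl i j c x) = wt (exch A) x + c]. *)
Definition exch A := if (i \in A) && (j \notin A) then j |: (A :\ i) else A.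

Lemma in_exch A k : (k \in exch A) =
  if k == j then (j \in A) || (i \in A)
  else if k == i then (i \in A) && (j \in A) else k \in A.
Proof.
have ni : j != i by rewrite eq_sym.
rewrite /exch; case iA: (i \in A); case jA: (j \in A); rewrite /= ?inE;
case: (eqVneq k j) => [->|kj]; rewrite ?eqxx ?(negbTE ni) ?iA ?jA //=;
by case: (eqVneq k i) => [->|ki]; rewrite ?iA ?jA.
Qed.

(** The excluded pairs are those where one set contains only [i] and the other only [j]: their union
    is fixed by [exch], but the union of their images loses [i]. *)
Lemma exchU A B :
  ~~ [&& i \in A, j \notin A, i \notin B & j \in B] ->
  ~~ [&& i \in B, j \notin B, i \notin A & j \in A] ->
  exch (A :|: B) = exch A :|: exch B.
Proof.
move=> h1 h2; apply/setP=> k; rewrite !(inE, in_exch).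
case: (k == j); last case: (k == i) => //; move: h1 h2;
by do ?case: (_ \in _).
Qed.

Lemma exchI A B :
  ~~ [&& i \in A, j \notin A, i \notin B & j \in B] ->
  ~~ [&& i \in B, j \notin B, i \notin A & j \in A] ->
  exch (A :&: B) = exch A :&: exch B.
Proof.
move=> h1 h2; apply/setP=> k; rewrite !(inE, in_exch).
case: (k == j); last case: (k == i) => //; move: h1 h2;
by do ?case: (_ \in _).
Qed.

Variable c : int.
Hypothesis h1 : height i j c = 1.

(* If [f] is the support function of a down-set, this is the support function of
   its union with its image under [refl i j c]. *)
Definition lift_rank (f : {set 'I_n} -> int) A : int :=
  f (exch A) + if (i \in A) && (j \notin A) then c else 0.

Lemma wt_exch A x :
  wt (exch A) x =
  wt A x + if (i \in A) && (j \notin A) then x 0 j - x 0 i else 0.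
Proof.
rewrite /exch; case: ifP => [/andP[iA jA]|_]; last by rewrite addr0.
by rewrite wt_exchange // addrA.
Qed.

Variables (a : 'rV[int]_n) (f : {set 'I_n} -> int).
Hypothesis low_a : ~~ high i j c a.
Hypothesis pm : polymatroidal a f.

Let h0 : 0 < height i j c. Proof. by rewrite h1. Qed.

(** If [y] attains [f A], then [low i j c y] is still below [a], and its weight on [exch A] is at
    least [f A - c] when [exch] moves [A]. *)
Lemma rank_le_lift_rank A : f A <= lift_rank f A.
Proof.
rewrite /lift_rank /exch; case: ifP => [iAj|_]; last by rewrite addr0.
have [iA jA] := andP iAj; have [y ya <-] := pm_attained pm A.
have := pm_bound pm (exch A) (step_le_trans (low_le y nij h0) ya).
rewrite wt_exch iAj /exch iAj /low; case: ifP => hy.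
  by rewrite wt_refl !reflE // !eqxx (eq_sym j) (negbTE nij) iA (negbTE jA); lia.
by move: hy; rewrite /high; lia.
Qed.

Lemma lift_rank_submod_exch A B :
  [&& i \in A, j \notin A, i \notin B & j \in B] ->
  lift_rank f (A :|: B) + lift_rank f (A :&: B) <= lift_rank f A + lift_rank f B.
Proof.
move=> /and4P[iA jA iB jB]; rewrite /lift_rank /exch !inE iA (negbTE jA) jB.
rewrite (negbTE iB) /= !addr0.
set P := j |: (A :\ i).
have s1 := pm_submod pm P B.
(* [Z] is chosen so that [exch Z = P :&: B], while [P :|: B] and [Z] have union [A :|: B] and
   intersection [A :&: B]. The bound [f Z <= f (P :&: B) + c] then links the two submodular
   inequalities. *)
pose Z := i |: (A :&: B).
have s2 := pm_submod pm (P :|: B) Z.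
have s3 := rank_le_lift_rank Z.
have jZ : j \notin Z by rewrite !inE (negbTE jA) (eq_sym j) (negbTE nij).
have iZ : i \in Z by rewrite !inE eqxx.
move: s3; rewrite /lift_rank /exch iZ jZ /=.
have -> : j |: (Z :\ i) = P :&: B.
  apply/setP=> k; rewrite !inE.
  case: (eqVneq k j) => [->|_] //=.
  by case: (eqVneq k i) => [->|_]; rewrite ?(negbTE iB).
have E1 : P :|: B :|: Z = A :|: B.
  apply/setP=> k; rewrite !inE.
  case: (eqVneq k j) => [->|_]; rewrite ?jB ?orbT //=.
  case: (eqVneq k i) => [->|_]; rewrite ?iA ?orbT //=.
  by case: (k \in A); case: (k \in B).
have E2 : (P :|: B) :&: Z = A :&: B.
  apply/setP=> k; rewrite !inE.
  case: (eqVneq k j) => [->|_]; rewrite ?(negbTE jA) ?(eq_sym j) ?(negbTE nij) //=.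
  case: (eqVneq k i) => [->|_]; rewrite ?(negbTE iB) ?andbF //=.
  by case: (k \in A); case: (k \in B).
by move: s1 s2; rewrite E1 E2 /reverse_coercion; lia.
Qed.

Lemma lift_rank_submod A B :
  lift_rank f (A :|: B) + lift_rank f (A :&: B) <= lift_rank f A + lift_rank f B.
Proof.
have [hA|nA] := boolP [&& i \in A, j \notin A, i \notin B & j \in B].
  exact: lift_rank_submod_exch.
have [hB|nB] := boolP [&& i \in B, j \notin B, i \notin A & j \in A].
  rewrite finset.setUC finset.setIC [leRHS]addrC; exact: lift_rank_submod_exch.
rewrite /lift_rank exchU // exchI //; have := pm_submod pm (exch A) (exch B).
move: nA nB; rewrite !inE /reverse_coercion.
by do 4?case: (_ \in _) => /=; lia.
Qed.

Lemma lift_rank_attained A :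
  exists2 x, step_le x (refl i j c a) & wt A x = lift_rank f A.
Proof.
have [y ya yA] := pm_attained pm (exch A).
have lya : step_le (low i j c y) a := step_le_trans (low_le y nij h0) ya.
have [iAj|iAj] := boolP ((i \in A) && (j \notin A)).
  exists (refl i j c y); first by apply/step_le_reflE => //; rewrite low_refl.
  move: yA; rewrite /lift_rank wt_exch wt_refl iAj.
  by case/andP: iAj => -> /negbTE->; lia.
exists y; first exact/step_le_reflE.
by rewrite /lift_rank -yA wt_exch (negbTE iAj) !addr0.
Qed.

Lemma lift_rank_bound x A :
  step_le x (refl i j c a) -> wt A x <= lift_rank f A.
Proof.
move=> /(step_le_reflE _ nij h1 low_a) /(pm_bound pm (exch A)).
rewrite wt_exch /lift_rank /low; case: ifPn => hx.
  rewrite !wt_refl !reflE // !eqxx (eq_sym j) (negbTE nij); move: hx.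
  by rewrite /high; case: (i \in A); case: (j \in A) => /=; lia.
by move: hx; rewrite /high; case: ifP => _; lia.
Qed.

(** Reflecting a high point raises only the weights of sets with [j] but not [i]; such a set is the
    [exch] of the set with [i] in place of [j], whose bound is exactly the one required. *)
Lemma lift_rank_low x A : (forall A, wt A x <= lift_rank f A) ->
  wt A (low i j c x) <= lift_rank f A.
Proof.
move=> xf; rewrite /low; case: ifPn => [|_]; last exact: xf.
rewrite wt_refl /high => hx; have := xf A.
case iA: (i \in A); case jA: (j \in A) => /=; try lia.
move=> _; have := xf (i |: (A :\ j)).
rewrite wt_exchange ?iA // /lift_rank /exch iA /= !inE !eqxx /=.
rewrite (eq_sym j) (negbTE nij) /=.
have -> : j |: ((i |: A :\ j) :\ i) = A.
  apply/setP=> k; rewrite !inE.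
  case: (eqVneq k j) => [->|_]; rewrite ?jA //=.
  by case: (eqVneq k i) => [->|_]; rewrite ?iA.
by lia.
Qed.

Lemma lift_rank_saturated_low x : ~~ high i j c x ->
  (forall A, wt A x <= lift_rank f A) -> wt [set: _] x = wt [set: _] a ->
  step_le x a.
Proof.
move=> lx xf xT.
(* The least push that meets the bounds [f] on all sets with [i] but not [j]. *)
have [t [t0 tub tmax]] :=
  finset_nonneg_max (fun A => (i \in A) && (j \notin A)) (fun A => wt A x - f A).
apply: step_le_trans (le_shift nij h1 lx t0) _; apply: (pm_saturated pm) => [B|].
  rewrite wt_shift.
  case iB: (i \in B); case jB: (j \in B) => /=;
    have := xf B; rewrite {1}/lift_rank /exch iB jB /=; try lia.
    by have := tub B; rewrite iB jB => /(_ isT); lia.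
  (* Here [B] contains only [j] and bounds the push from above. The union [A :|: B] contains both
     indices and [A :&: B] neither, so [lift_rank f] agrees with [f] on them and submodularity
     applies. *)
  case: tmax => [->|[A /andP[iA jA] ->]]; first by lia.
  have := pm_submod pm A B; have := wt_modular A B x.
  have := xf (A :|: B); have := xf (A :&: B).
  rewrite /lift_rank /exch !inE iA (negbTE jA) iB jB /=; lia.
by rewrite wt_shift !inE subrr mulr0 addr0.
Qed.

Lemma polymatroidal_refl : polymatroidal (refl i j c a) (lift_rank f).
Proof.
split; [exact: lift_rank_submod|exact: lift_rank_attained
       |exact: lift_rank_bound|].
move=> x xf xT; apply/step_le_reflE => //.
apply: lift_rank_saturated_low => [|A|].
- rewrite /low; case: ifPn => // hx; rewrite high_refl //.
  by move: hx; rewrite /high; lia.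
- exact: lift_rank_low.
transitivity (wt [set: _] x); first exact/step_le_total/low_le.
by rewrite xT wt_refl !inE subrr mulr0 addr0.
Qed.

End Exchange.

(** * Induction on the distance to the alcove *)

(* n times the vector joining [x] to the point (- k / n)_k of the fundamental
   alcove has coordinates n x_k + k. *)
Definition energy x : int := \sum_k (n%:Z * x 0 k + k%:Z) ^+ 2.

Lemma energy_ge0 x : 0 <= energy x.
Proof. by apply: sumr_ge0 => k _; apply: sqr_ge0. Qed.

(** The drop is [2 * height i j c * n * (x 0 i - x 0 j - c)]. *)
Lemma energy_refl i j c x : i != j -> 0 < height i j c -> high i j c x ->
  energy (refl i j c x) < energy x.
Proof.
move=> nij; rewrite /energy !(bigD1 i (P := xpredT)) //=.
rewrite !(bigD1 j (P := fun k => k != i)) 1?eq_sym //=.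
rewrite !reflE // !eqxx (eq_sym j) (negbTE nij).
under eq_bigr => k /andP[ki kj] do rewrite reflE // (negbTE ki) (negbTE kj).
rewrite !addrA ltrD2r /height /high.
move: (x 0 i) (x 0 j) (ltn_ord i) => u v; move: (i : nat) (j : nat) => p q.
move=> pn h0 uv; rewrite -subr_gt0.
have -> : (n%:Z * u + p%:Z) ^+ 2 + (n%:Z * v + q%:Z) ^+ 2
   - ((n%:Z * (v + c) + p%:Z) ^+ 2 + (n%:Z * (u - c) + q%:Z) ^+ 2)
   = 2 * (n%:Z * c + p%:Z - q%:Z) * n%:Z * (u - v - c) by ring.
by rewrite !mulr_gt0 // ?subr_gt0 //; lia.
Qed.

(* A positive root of height m + 1 is the sum of a simple root and one of height
   m; intermediate roots with i = j are imaginary and impose only 0 <= c. *)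
Lemma low_all i j c x :
  (forall i j c, i != j -> height i j c = 1 -> ~~ high i j c x) ->
  0 <= height i j c -> x 0 i - x 0 j <= c.
Proof.
move=> lx hge; have [m] : exists m : nat, height i j c = m.
  by exists `|height i j c|%N; lia.
elim: m i c {hge} => [|m IH] i c hm.
  have [E|nij] := eqVneq i j; last by have := height_neq0 c nij; lia.
  rewrite {}E in hm *.
  rewrite subrr; move: hm (ltn_ord j); rewrite /height.
  by case: (lerP 0 c) => // c0; nia.
have [i' [c' [hi' hlow]]] : exists i' c', height i' j c' = m /\
    x 0 i - x 0 i' <= c - c'.
  have ext i' c' : height i i' (c - c') = 1 ->
      height i' j c' = m /\ x 0 i - x 0 i' <= c - c'.
    move=> h1; split; first by move: h1 hm; rewrite /height; lia.
    have [E|nii] := eqVneq i i'; last by have := lx _ _ _ nii h1; rewrite /high; lia.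
    move: h1; rewrite -E subrr /height.
    by move: (ltn_ord i); nia.
  case i0: (i : nat) => [|p].
    (* Indices are cyclic: the predecessor of 0 is [n - 1], with the constant lowered by 1. *)
    have n0 : (n.-1 < n)%N by have := ltn_ord i; lia.
    exists (Ordinal n0), (c - 1); apply: ext; rewrite /height /= i0.
    by have := ltn_ord i; lia.
  have pn : (p < n)%N by have := ltn_ord i; lia.
  by exists (Ordinal pn), c; apply: ext; rewrite /height /= i0; lia.
by have := IH i' c' hi'; lia.
Qed.

(** With equal total weights, the bounds on a singleton and on its complement determine each
    coordinate. *)
Lemma polymatroidal_minimal a : (forall y, step_le y a -> y = a) ->
  polymatroidal a (fun A => wt A a).
Proof.
move=> mina; split=> [A B|A|x A /mina->|x xa xT] //.
- by have := wt_modular A B a; rewrite /reverse_coercion => ->.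
- by exists a => //; apply: step_le_refl.
suff -> : x = a by exact: step_le_refl.
apply/rowP=> k.
have split y : wt [set: _] y = y 0 k + wt (~: [set k]) y.
  rewrite /wt (bigD1 k) ?inE //=; congr (_ + _).
  by apply: eq_bigl => l; rewrite !inE.
have x1 : x 0 k <= a 0 k by have := xa [set k]%SET; rewrite /wt !big_set1.
by have := xa (~: [set k]); move: xT; rewrite !split; lia.
Qed.

Lemma polymatroidal_exists a : exists f, polymatroidal a f.
Proof.
have [m] : exists m : nat, (`|energy a| < m)%N by exists `|energy a|.+1%N.
elim: m a => // m IH a am.
have [[i [j [c [nij h1 ha]]]]|none] :=
    pselect (exists i j c, [/\ i != j, height i j c = 1 & high i j c a]).
  have h0 : 0 < height i j c by rewrite h1.
  have [|f pf] := IH (refl i j c a).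
    have := energy_refl nij h0 ha; have := energy_ge0 a.
    by have := energy_ge0 (refl i j c a); lia.
  exists (lift_rank i j c f); rewrite -(reflK c nij a).
  apply: polymatroidal_refl => //; rewrite high_refl //.
  by move: ha; rewrite /high; lia.
exists (fun A => wt A a); apply: polymatroidal_minimal => y.
have lowa : forall i j c, i != j -> height i j c = 1 -> ~~ high i j c a.
  by move=> i j c nij h1; apply/negP => ha; apply: none; exists i, j, c.
(* A point that no simple root can lower is lowered by no positive root. *)
have nostep z : ~ step a z.
  by case=> i j c _ /ltW/(low_all lowa); lia.
move=> ya; move: ya nostep; rewrite /step_le.
elim=> {y a am IH none lowa} [x y xy nx|//|x y z _ IH1 _ IH2 nx].
  by case: (nx _ xy).
by have xy := IH1 nx; move: (IH2); rewrite xy => ->.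
Qed.

(** * Comparison with the order generated by swaps and moves *)

Lemma xcol_refl i j x : i != j -> xcol i j x = refl i j 0 x.
Proof.
move=> nij; apply/rowP=> k; rewrite reflE // mxE addr0 subr0.
case: tpermP => [->|->|/eqP/negbTE-> /eqP/negbTE->] //; rewrite ?eqxx //.
by rewrite eq_sym (negbTE nij).
Qed.

(** A swap is the reflection in [(e_j - e_i, 0)]; a move is the reflection in [(e_i - e_j, 1)]
    applied to the swapped vector. *)
Lemma bruhat_le_step y a : bruhat_le y a -> step_le y a.
Proof.
elim=> {y a} [y z|x|x y z _ xy _ yz]; [|exact: rt_refl|exact: rt_trans xy yz].
case=> {y z} [l i j ij lij|l i j ij lij d1]; have nij : i != j by rewrite neq_ltn ij.
  have nji : j != i by rewrite eq_sym.
  apply: rt_step; rewrite xcol_refl //.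
  have -> : refl i j 0 l = refl j i 0 l.
    apply/rowP=> k; rewrite !reflE // !addr0 ?subr0.
    by case: (eqVneq k i) => [->|//]; rewrite (negbTE nij).
  by apply: Step => //; rewrite /height; lia.
apply: rt_step.
have -> : l + delta_mx 0 i - delta_mx 0 j = refl i j 1 (xcol i j l).
  rewrite xcol_refl //; apply/rowP=> k; rewrite !reflE // !mxE !eqxx /=.
  rewrite (eq_sym j) (negbTE nij).
  case: (eqVneq k i) => [->|_]; rewrite ?(negbTE nij); first by lia.
  by case: (eqVneq k j) => [->|_]; lia.
apply: Step => //; first by rewrite /height; have := ltn_ord j; lia.
by rewrite xcol_refl // !reflE // !eqxx (eq_sym j) (negbTE nij); lia.
Qed.

Lemma bruhat_swap i j x : (i < j)%N -> x 0 i < x 0 j ->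
  bruhat_le (refl i j 0 x) x.
Proof.
move=> ij xij; rewrite -xcol_refl ?neq_ltn ?ij //.
exact/rt_step/bruhat_gen_swap.
Qed.

Lemma bruhat_move i j x : (i < j)%N -> 1 < x 0 i - x 0 j ->
  bruhat_le (refl i j 1 x) x.
Proof.
move=> ij xij; have nij : i != j by rewrite neq_ltn ij.
set l := refl i j 0 x.
have li : l 0 i = x 0 j by rewrite reflE // eqxx addr0.
have lj : l 0 j = x 0 i by rewrite reflE // eq_sym (negbTE nij) eqxx subr0.
have -> : refl i j 1 x = l + delta_mx 0 i - delta_mx 0 j.
  apply/rowP=> k; rewrite !mxE !eqxx.
  case: (eqVneq k i) => [->|ki]; rewrite ?(negbTE nij) /=; first by lia.
  by case: (eqVneq k j) => [->|kj] /=; lia.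
have xE : x = xcol i j l by rewrite xcol_refl // reflK.
rewrite [X in bruhat_le _ X]xE.
by apply/rt_step/bruhat_gen_move => //; rewrite li lj; lia.
Qed.

Lemma bruhat_shift i j t x : (i < j)%N -> 0 <= t < x 0 i - x 0 j ->
  bruhat_le (shift j i t x) x.
Proof.
move=> ij ht; have nij : i != j by rewrite neq_ltn ij.
have [m tm] : exists m : nat, t = m by exists `|t|%N; lia.
have shE y s k : shift j i s y 0 k =
    if k == i then y 0 i - s else if k == j then y 0 j + s else y 0 k.
  rewrite shiftE; case: (eqVneq k i) => [->|ki].
    by rewrite (negbTE nij); lia.
  by case: (eqVneq k j) => [->|kj]; lia.
rewrite {}tm in ht *; elim: m x ht => [|m IH] x ht.
  by rewrite /shift scale0r addr0; apply: rt_refl.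
(* The longest shift is a single [bruhat_move]. Otherwise a move followed by a swap transfers one
   unit and narrows the gap by 2. *)
case: (eqVneq (m.+2)%:Z (x 0 i - x 0 j)) => [mE|mN].
  suff -> : shift j i m.+1 x = refl i j 1 x by apply: bruhat_move => //; lia.
  apply/rowP=> k; rewrite shE reflE //.
  by case: eqVneq => _; [|case: eqVneq => _]; lia.
set y := refl i j 1 x; set z := refl i j 0 y.
have yi : y 0 i = x 0 j + 1 by rewrite reflE // eqxx.
have yj : y 0 j = x 0 i - 1 by rewrite reflE // eq_sym (negbTE nij) eqxx.
have zi : z 0 i = x 0 i - 1 by rewrite reflE // eqxx; lia.
have zj : z 0 j = x 0 j + 1 by rewrite reflE // eq_sym (negbTE nij) eqxx; lia.
have yx : bruhat_le y x by apply: bruhat_move => //; lia.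
have zy : bruhat_le z y by apply: bruhat_swap => //; lia.
have -> : shift j i m.+1 x = shift j i m z.
  apply/rowP=> k; rewrite !shE zi zj.
  case: (eqVneq k i) => [_|ki]; first by lia.
  case: (eqVneq k j) => [_|kj]; first by lia.
  by rewrite !reflE // (negbTE ki) (negbTE kj).
apply: rt_trans (rt_trans _ _ _ _ _ yx zy) _.
by apply: IH => //; rewrite zi zj; lia.
Qed.

Lemma step_le_bruhat y a : step_le y a -> bruhat_le y a.
Proof.
elim=> {y a} [y z|x|x y z _ xy _ yz]; [|exact: rt_refl|exact: rt_trans xy yz].
case=> i j c nij; rewrite /height => h0 yc.
case: (ltngtP i j) => [ij|ji|/val_inj ijE]; last by rewrite ijE eqxx in nij.
  (* Positive height forces [1 <= c], so the reflection is a shift shorter than the gap. *)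
  have c1 : 1 <= c by have := ltn_ord j; nia.
  suff -> : refl i j c y = shift j i (y 0 i - y 0 j - c) y.
    by apply: bruhat_shift => //; lia.
  by apply/rowP=> k; rewrite !shiftE; lia.
(* Here the reflection is a swap followed by a shift of length [c]. *)
have c0 : 0 <= c by have := ltn_ord i; nia.
set w := refl j i 0 y.
have nji : j != i by rewrite eq_sym.
have wi : w 0 i = y 0 j by rewrite reflE // (negbTE nij) eqxx subr0.
have wj : w 0 j = y 0 i by rewrite reflE // eqxx addr0.
have wy : bruhat_le w y by apply: bruhat_swap => //; lia.
apply: rt_trans wy _.
suff -> : refl i j c y = shift i j c w.
  by apply: bruhat_shift => //; rewrite wi wj; lia.
by apply/rowP=> k; rewrite /w /refl !shiftE; lia.
Qed.

End Bruhat.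

(** * Linear inequalities on the convex hull *)

Lemma convex_hull_half_space (R : realType) (n : nat) (S : set 'rV[R]_n)
    (w : 'I_n -> R) (b : R) (v : 'rV[R]_n) :
  (forall u, S u -> \sum_k w k * u 0 k <= b) -> convex_hull S v ->
  \sum_k w k * v 0 k <= b.
Proof.
move=> Sb hv; apply: (hv [set u : 'rV[R]_n | \sum_k w k * u 0 k <= b]).
split=> // x y l; rewrite !inE /= => xb yb.
have -> : \sum_k w k * (conv l x y : 'rV[R]_n) 0 k =
    l%:num * \sum_k w k * x 0 k + (1 - l%:num) * \sum_k w k * y 0 k.
  rewrite !mulr_sumr -big_split /=; apply: eq_bigr => k _.
  by rewrite !mxE /unstable.onem; ring.
have -> : b = l%:num * b + (1 - l%:num) * b by ring.
by apply: lerD; apply: ler_wpM2l => //; rewrite subr_ge0.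
Qed.

(** The factor [t] carries a sign: 1 transfers upper bounds on a weight and -1 lower bounds, which
    together fix the total weight. *)
Lemma P_hat_wt_le (R : realType) (n : nat) (alpha beta : 'rV[int]_n)
    (A : {set 'I_n}) (t s : int) :
  P_hat R alpha (int_vec R beta) ->
  (forall x, bruhat_le x alpha -> t * wt A x <= s) -> t * wt A beta <= s.
Proof.
have wE x : \sum_k (t * (k \in A)%:R)%:~R * (int_vec R x) 0 k =
    (t * wt A x)%:~R :> R.
  rewrite /wt mulr_sumr rmorph_sum /= [in RHS]big_mkcond /=; apply: eq_bigr => k _.
  by rewrite mxE; case: (k \in A); rewrite ?mulr1 ?mulr0 ?mul0r // rmorphM.
move=> hull ts; rewrite -(ler_int R) -wE.
apply: convex_hull_half_space hull => _ [x xa <-].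
by rewrite wE ler_int; apply: ts.
Qed.

Theorem corollary5p7 (R : realType) (n : nat) (alpha beta : 'rV[int]_n) :
  (1 <= n)%N ->
  (forall i, 0 <= alpha 0 i) ->
  P_hat R alpha (int_vec R beta) ->
  (forall i, 0 <= beta 0 i) ->
  bruhat_le beta alpha.
Proof.
move=> _ _ hull _; apply: step_le_bruhat.
have [f pf] := polymatroidal_exists alpha.
have total x : bruhat_le x alpha -> wt [set: _] x = wt [set: _] alpha.
  by move/bruhat_le_step/step_le_total.
apply: (pm_saturated pf) => [A|].
  rewrite -[wt A beta]mul1r; apply: P_hat_wt_le hull _ => x xa.
  by rewrite mul1r; apply/(pm_bound pf)/bruhat_le_step.
apply: le_anti; apply/andP; split.
  rewrite -[wt _ beta]mul1r; apply: P_hat_wt_le hull _ => x /total->.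
  by rewrite mul1r.
rewrite -lerN2 -mulN1r; apply: P_hat_wt_le hull _ => x /total->.
by rewrite mulN1r.
Qed.
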